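(* For every $\gamma,\delta>1$ there exist constants $C,C'>0$ depending only on $\gamma$ and $\delta$ such that the following holds. Let $0<\mu_x\le L_x$, $0<\mu_y\le L_y$, $L_{xy}\ge0$, $f\in\mathcal F(\mu_x,\mu_y,L_x,L_y,L_{xy})$, and let $$\alpha=C\min\left\{\frac1{L_x},\frac{\sqrt{\mu_y}}{L_{xy}\sqrt{\mu_x}}\right\},\qquad \beta=C\min\left\{\frac1{L_y},\frac{\sqrt{\mu_x}}{L_{xy}\sqrt{\mu_y}}\right\}.$$ Then for every initialization $(x_0,y_0)$ and every $\epsilon>0$, the iterates of Alex-GDA with parameters $\gamma,\delta$ and step sizes $\alpha,\beta$ satisfy $\|z_K-z_\star\|^2\le\epsilon$ for every integer $K\ge0$ with $$K\ge C'\,(\kappa_x+\kappa_y+\kappa_{xy})\cdot\log\frac{\Psi^{\mathrm{Alex}}_0}{A^{\mathrm{Alex}}\epsilon},\qquad A^{\mathrm{Alex}}=\min\left\{\frac1{2\alpha},\frac1\beta\right\}>0 .$$ (That is, Alex-GDA converges linearly with iteration complexity $\mathcal O\big((\kappa_x+\kappa_y+\kappa_{xy})\log\frac{\Psi^{\mathrm{Alex}}_0}{A^{\mathrm{Alex}}\epsilon}\big)$. The constant $C$ can be taken such that, for all $\alpha,\beta>0$ bounded above by the displayed expressions, $\Psi^{\mathrm{Alex}}_{k+1}\le\max\{1-\alpha\mu_x,1-\beta\mu_y\}\Psi^{\mathrm{Alex}}_k$ for all $k\ge0$; the displayed $\alpha,\beta$ are the maximum step sizes allowed by these bounds.)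
   Context: Function class. For $0<\mu_x\le L_x$, $0<\mu_y\le L_y$, $L_{xy}\ge0$, $\mathcal F(\mu_x,\mu_y,L_x,L_y,L_{xy})$ is the set of all twice-differentiable $f:\mathbb R^{d_x}\times\mathbb R^{d_y}\to\mathbb R$ (any $d_x,d_y$) such that: (i) $f(\cdot,y)$ is $\mu_x$-strongly convex for every $y$ and $f(x,\cdot)$ is $\mu_y$-strongly concave for every $x$ ($g$ is $\mu$-strongly convex if $g(z')\ge g(z)+\langle\nabla g(z),z'-z\rangle+\frac\mu2\|z'-z\|^2$ for all $z,z'$; $g$ is $\mu$-strongly concave if $-g$ is $\mu$-strongly convex); (ii) for all $x,x',y,y'$: $\|\nabla_xf(x',y)-\nabla_xf(x,y)\|\le L_x\|x'-x\|$, $\|\nabla_yf(x,y')-\nabla_yf(x,y)\|\le L_y\|y'-y\|$, $\|\nabla_xf(x,y')-\nabla_xf(x,y)\|\le L_{xy}\|y'-y\|$, $\|\nabla_yf(x',y)-\nabla_yf(x,y)\|\le L_{xy}\|x'-x\|$. Norms are Euclidean. Every such $f$ has a unique Nash equilibrium $z_\star=(x_\star,y_\star)$, i.e. a point with $f(x_\star,y)\le f(x_\star,y_\star)\le f(x,y_\star)$ for all $x,y$. Condition numbers: $\kappa_x=L_x/\mu_x$, $\kappa_y=L_y/\mu_y$, $\kappa_{xy}=L_{xy}/\sqrt{\mu_x\mu_y}$. Alex-GDA with step sizes $\alpha,\beta>0$ and parameters $\gamma,\delta\ge0$: start from $(x_0,y_0)$ with $\tilde y_0=y_0$, and for $k\ge0$: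 $x_{k+1}=x_k-\alpha\nabla_xf(x_k,\tilde y_k)$, $\tilde x_{k+1}=x_k-\gamma\alpha\nabla_xf(x_k,\tilde y_k)$, $y_{k+1}=y_k+\beta\nabla_yf(\tilde x_{k+1},y_k)$, $\tilde y_{k+1}=y_k+\delta\beta\nabla_yf(\tilde x_{k+1},y_k)$. Write $z_k=(x_k,y_k)$. Lyapunov function: with $V(x,y)=\frac1\alpha\|x-x_\star\|^2+\frac1\beta\|y-y_\star\|^2$, for $k\ge1$ $$\Psi^{\mathrm{Alex}}_k=V(x_k,y_k)+V(x_{k+1},y_k)-\alpha\|\nabla_xf(x_k,\tilde y_k)\|^2+(\delta-1)\beta\|\nabla_yf(\tilde x_k,y_{k-1})\|^2+\frac{(\gamma-1)(\delta-1)\alpha\beta}{1-\alpha\mu_x}L_{xy}\sqrt{\tfrac{\mu_y}{\mu_x}}\,\|\nabla_xf(x_{k-1},\tilde y_{k-1})\|^2,$$ and $$\Psi^{\mathrm{Alex}}_0=V(x_0,y_0)+V(x_1,y_0)-\alpha\|\nabla_xf(x_0,\tilde y_0)\|^2+\frac{(\gamma-1)(\delta-1)\alpha\beta}{(1-\alpha\mu_x)(1-\beta\mu_y)}L_{xy}\sqrt{\tfrac{\mu_y}{\mu_x}}\,\|\nabla_xf(x_0,\tilde y_0)\|^2 .$$ Conventions: if $L_{xy}=0$, a fraction with $L_{xy}$ in the denominator is $+\infty$; $\log0=-\infty$. *)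

(* Defs.v *)
From HB Require Import structures.
From mathcomp Require Import all_boot all_order all_algebra.
From mathcomp Require Import all_classical all_reals all_analysis.
Import Order.TTheory GRing.Theory Num.Theory.
Import numFieldNormedType.Exports.
Set Implicit Arguments.
Unset Strict Implicit.
Unset Printing Implicit Defensive.
Local Open Scope ring_scope.

(* R^n is 'rV[R]_n. The library norm `|u| on 'rV[R]_n is the sup norm: it is
   used below only through differentiability and derivatives (norm-independent
   in finite dimension), while all metric quantities use the Euclidean norm [enorm]. *)
Definition dot (R : realType) (n : nat) (u v : 'rV[R]_n) : R :=
  \sum_(i < n) u ord0 i * v ord0 i.

Definition enorm (R : realType) (n : nat) (u : 'rV[R]_n) : R :=
  Num.sqrt (dot u u).

(* The vector of partial derivatives. *)
Definition gradient (R : realType) (n : nat) (g : 'rV[R]_n -> R)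
    (u : 'rV[R]_n) : 'rV[R]_n :=
  \row_(i < n) 'D_(delta_mx ord0 i) g u.

Definition gradx (R : realType) (dx dy : nat)
    (f : 'rV[R]_dx * 'rV[R]_dy -> R) (x : 'rV[R]_dx) (y : 'rV[R]_dy) :
    'rV[R]_dx :=
  gradient (fun x' => f (x', y)) x.

Definition grady (R : realType) (dx dy : nat)
    (f : 'rV[R]_dx * 'rV[R]_dy -> R) (x : 'rV[R]_dx) (y : 'rV[R]_dy) :
    'rV[R]_dy :=
  gradient (fun y' => f (x, y')) y.

Definition twice_differentiable (R : realType) (dx dy : nat)
    (f : 'rV[R]_dx * 'rV[R]_dy -> R) : Prop :=
  (forall z, differentiable f z) /\
  (forall z, differentiable
     (fun w : 'rV[R]_dx * 'rV[R]_dy => (gradx f w.1 w.2, grady f w.1 w.2)) z).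

Definition strongly_convex (R : realType) (n : nat) (mu : R)
    (g : 'rV[R]_n -> R) : Prop :=
  forall z z' : 'rV[R]_n,
    g z + dot (gradient g z) (z' - z) + mu / 2 * enorm (z' - z) ^+ 2 <= g z'.

Definition strongly_concave (R : realType) (n : nat) (mu : R)
    (g : 'rV[R]_n -> R) : Prop :=
  strongly_convex mu (fun z => - g z).

Record function_class (R : realType) (dx dy : nat) (mux muy Lx Ly Lxy : R)
    (f : 'rV[R]_dx * 'rV[R]_dy -> R) : Prop := FunctionClass {
  fc_twice_differentiable : twice_differentiable f;
  fc_strongly_convex : forall y, strongly_convex mux (fun x => f (x, y));
  fc_strongly_concave : forall x, strongly_concave muy (fun y => f (x, y));
  fc_gradx_lip_x : forall x x' y,
    enorm (gradx f x' y - gradx f x y) <= Lx * enorm (x' - x);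
  fc_grady_lip_y : forall x y y',
    enorm (grady f x y' - grady f x y) <= Ly * enorm (y' - y);
  fc_gradx_lip_y : forall x y y',
    enorm (gradx f x y' - gradx f x y) <= Lxy * enorm (y' - y);
  fc_grady_lip_x : forall x x' y,
    enorm (grady f x' y - grady f x y) <= Lxy * enorm (x' - x) }.

Definition nash_equilibrium (R : realType) (dx dy : nat)
    (f : 'rV[R]_dx * 'rV[R]_dy -> R) (xs : 'rV[R]_dx) (ys : 'rV[R]_dy) : Prop :=
  (forall y, f (xs, y) <= f (xs, ys)) /\ (forall x, f (xs, ys) <= f (x, ys)).

(* [xt k], [yt k] are the extrapolated iterates; the value [xt 0] is
   unconstrained and never used. *)
Record alex_gda (R : realType) (dx dy : nat)
    (f : 'rV[R]_dx * 'rV[R]_dy -> R) (alpha beta gamma delta : R)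
    (x xt : nat -> 'rV[R]_dx) (y yt : nat -> 'rV[R]_dy) : Prop := AlexGDA {
  alex_yt0 : yt 0%N = y 0%N;
  alex_x : forall k, x k.+1 = x k - alpha *: gradx f (x k) (yt k);
  alex_xt : forall k, xt k.+1 = x k - (gamma * alpha) *: gradx f (x k) (yt k);
  alex_y : forall k, y k.+1 = y k + beta *: grady f (xt k.+1) (y k);
  alex_yt : forall k, yt k.+1 = y k + (delta * beta) *: grady f (xt k.+1) (y k) }.

Definition lyap_V (R : realType) (dx dy : nat) (alpha beta : R)
    (xs : 'rV[R]_dx) (ys : 'rV[R]_dy) (x : 'rV[R]_dx) (y : 'rV[R]_dy) : R :=
  alpha^-1 * enorm (x - xs) ^+ 2 + beta^-1 * enorm (y - ys) ^+ 2.

Definition psi_alex (R : realType) (dx dy : nat)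
    (f : 'rV[R]_dx * 'rV[R]_dy -> R) (mux muy Lxy alpha beta gamma delta : R)
    (xs : 'rV[R]_dx) (ys : 'rV[R]_dy)
    (x xt : nat -> 'rV[R]_dx) (y yt : nat -> 'rV[R]_dy) (k : nat) : R :=
  let V := lyap_V alpha beta xs ys in
  let N := (gamma - 1) * (delta - 1) * alpha * beta in
  let r := Lxy * Num.sqrt (muy / mux) in
  match k with
  | 0%N =>
      V (x 0%N) (y 0%N) + V (x 1%N) (y 0%N)
      - alpha * enorm (gradx f (x 0%N) (yt 0%N)) ^+ 2
      + N / ((1 - alpha * mux) * (1 - beta * muy)) * r
        * enorm (gradx f (x 0%N) (yt 0%N)) ^+ 2
  | j.+1 =>
      V (x k) (y k) + V (x k.+1) (y k)
      - alpha * enorm (gradx f (x k) (yt k)) ^+ 2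
      + (delta - 1) * beta * enorm (grady f (xt k) (y j)) ^+ 2
      + N / (1 - alpha * mux) * r * enorm (gradx f (x j) (yt j)) ^+ 2
  end.

(* min {1 / L, sqrt nu / (Lxy * sqrt mu)}, the second term being +oo when
   Lxy = 0 (division by zero would give 0 in the library). *)
Definition step_bound (R : realType) (L Lxy mu nu : R) : R :=
  if Lxy == 0 then 1 / L
  else Num.min (1 / L) (Num.sqrt nu / (Lxy * Num.sqrt mu)).

Definition A_alex (R : realType) (alpha beta : R) : R :=
  Num.min (1 / (2 * alpha)) (1 / beta).

(* Main.v *)
(** Put [h_0 = 0], so that [yt_k = y_k + (delta - 1) beta h_k] for every [k],
    where [g_k] and [h_(k+1)] are the gradients used in the x- and y-updates.
    Expanding the squares, [Psi_(k+1) - Psi_k] equals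
    [-2<g_k, x_k - x*> - 2<g_(k+1), x_(k+1) - x*> + 4<h_(k+1), y_k - y*>] plus
    multiples of squared gradient norms.  The gradient inequalities at these
    three points, together with the Nash property, replace the inner products by
    [-mux |x_k - x*|^2 - mux |x_(k+1) - x*|^2 - 2 muy |y_k - y*|^2] (exactly the
    decrease the rate asks for) and the difference
    [2 (2 f(xt_(k+1), y_k) - f(x_k, yt_k) - f(x_(k+1), yt_(k+1)))].  Both halves
    of the latter are telescoped through one-variable moves along [g_k] or [h_k],
    each of which gains a negative multiple of [alpha |g|^2] or [beta |h|^2];
    since [gamma, delta > 1] these gains beat all remaining terms once the
    constant [C] is small. *)
Require Import Defs.
From HB Require Import structures.
From mathcomp Require Import all_boot all_order all_algebra.
From mathcomp Require Import all_classical all_reals all_analysis.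
From mathcomp Require Import ring lra.
Import Order.TTheory GRing.Theory Num.Theory.
Import numFieldNormedType.Exports.
Set Implicit Arguments.
Unset Strict Implicit.
Unset Printing Implicit Defensive.
Local Open Scope ring_scope.

(** * Euclidean inner product and norm *)

Lemma dotC (R : realType) n (u v : 'rV[R]_n) : dot u v = dot v u.
Proof. by apply: eq_bigr => i _; rewrite mulrC. Qed.

Lemma dotDl (R : realType) n (u v w : 'rV[R]_n) :
  dot (u + v) w = dot u w + dot v w.
Proof. by rewrite -big_split; apply: eq_bigr => i _; rewrite mxE mulrDl. Qed.

Lemma dotZl (R : realType) n (t : R) (u w : 'rV[R]_n) :
  dot (t *: u) w = t * dot u w.
Proof. by rewrite mulr_sumr; apply: eq_bigr => i _; rewrite mxE mulrA. Qed.

Lemma dotNl (R : realType) n (u w : 'rV[R]_n) : dot (- u) w = - dot u w.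
Proof. by rewrite -scaleN1r dotZl mulN1r. Qed.

Lemma dotDr (R : realType) n (u v w : 'rV[R]_n) :
  dot w (u + v) = dot w u + dot w v.
Proof. by rewrite dotC dotDl !(dotC w). Qed.

Lemma dotZr (R : realType) n (t : R) (u w : 'rV[R]_n) :
  dot w (t *: u) = t * dot w u.
Proof. by rewrite dotC dotZl dotC. Qed.

Lemma dotNr (R : realType) n (u w : 'rV[R]_n) : dot w (- u) = - dot w u.
Proof. by rewrite dotC dotNl dotC. Qed.

Lemma dotvv_ge0 (R : realType) n (u : 'rV[R]_n) : 0 <= dot u u.
Proof. by apply: sumr_ge0 => i _; rewrite -expr2 sqr_ge0. Qed.

Lemma enorm_sqr (R : realType) n (u : 'rV[R]_n) : enorm u ^+ 2 = dot u u.
Proof. by rewrite sqr_sqrtr // dotvv_ge0. Qed.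

Lemma enorm_ge0 (R : realType) n (u : 'rV[R]_n) : 0 <= enorm u.
Proof. exact: sqrtr_ge0. Qed.

Lemma enorm_eq0 (R : realType) n (u : 'rV[R]_n) : enorm u = 0 -> u = 0.
Proof.
move=> u0; have /eqP : dot u u = 0 by rewrite -enorm_sqr u0 expr0n.
rewrite psumr_eq0 => [/allP uu0|i _]; last by rewrite -expr2 sqr_ge0.
apply/rowP => i; rewrite mxE.
by have /eqP := uu0 i (mem_index_enum i); rewrite -expr2 => /eqP; rewrite sqrf_eq0 => /eqP.
Qed.

Lemma enormZ (R : realType) n (t : R) (u : 'rV[R]_n) :
  enorm (t *: u) = `|t| * enorm u.
Proof.
by rewrite /enorm dotZl dotZr mulrA -expr2 sqrtrM ?sqr_ge0// sqrtr_sqr.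
Qed.

Lemma enormN (R : realType) n (u : 'rV[R]_n) : enorm (- u) = enorm u.
Proof. by rewrite -scaleN1r enormZ normrN1 mul1r. Qed.

Lemma enorm0 (R : realType) n : enorm (0 : 'rV[R]_n) = 0.
Proof. by rewrite -(scale0r 0) enormZ normr0 mul0r. Qed.

Lemma cauchy_schwarz (R : realType) n (u v : 'rV[R]_n) :
  dot u v <= enorm u * enorm v.
Proof.
have [u0|u0] := eqVneq (enorm u) 0.
  rewrite u0 mul0r (enorm_eq0 u0) -(scale0r (0 : 'rV_n)) dotZl mul0r //.
have [v0|v0] := eqVneq (enorm v) 0.
  rewrite v0 mulr0 (enorm_eq0 v0) -(scale0r (0 : 'rV_n)) dotZr mul0r //.
have uv0 : 0 < enorm u * enorm v.
  by rewrite mulr_gt0 // lt_neqAle eq_sym ?u0 ?v0 enorm_ge0.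
rewrite -subr_ge0 -(pmulr_rge0 _ uv0).
have := dotvv_ge0 (enorm v *: u - enorm u *: v).
rewrite !(dotDl, dotDr, dotNl, dotNr, dotZl, dotZr) -!enorm_sqr (dotC v u).
by move=> h; nra.
Qed.

Lemma enormD (R : realType) n (u v : 'rV[R]_n) :
  enorm (u + v) <= enorm u + enorm v.
Proof.
rewrite -(@ler_pXn2r _ 2%N) ?nnegrE ?addr_ge0 ?enorm_ge0//.
rewrite enorm_sqr !(dotDl, dotDr) -!enorm_sqr (dotC v u).
by have := cauchy_schwarz u v; nra.
Qed.

Lemma enormB (R : realType) n (u v : 'rV[R]_n) :
  enorm (u - v) <= enorm u + enorm v.
Proof. by rewrite -(enormN v) enormD. Qed.

Lemma enormB_sqr (R : realType) n (u v : 'rV[R]_n) :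
  enorm (u - v) ^+ 2 = enorm u ^+ 2 - 2 * dot v u + enorm v ^+ 2.
Proof.
rewrite !enorm_sqr !(dotDl, dotDr, dotNl, dotNr) (dotC u v); ring.
Qed.

(** * Gradient steps for strongly convex functions with Lipschitz gradient *)

Lemma gradientN (R : realType) n (g : 'rV[R]_n -> R) (u : 'rV[R]_n) :
  differentiable g u -> gradient (fun z => - g z) u = - gradient g u.
Proof.
move=> dg; apply/rowP => i; rewrite !mxE.
by rewrite deriveN //; exact: diff_derivable.
Qed.

(** Convexity is applied at the end point, looking back to [z], and the Lipschitz bound exchanges
    the gradient there for the one at [z]. This avoids integrating along the segment, at the price
    of [L * t ^+ 2] instead of half of it, a loss that [C] absorbs. *)
Lemma gradient_descent (R : realType) n (mu L t : R) (g : 'rV[R]_n -> R)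
    (z : 'rV[R]_n) :
  0 <= mu -> 0 <= t -> strongly_convex mu g ->
  (forall u v, enorm (gradient g v - gradient g u) <= L * enorm (v - u)) ->
  g (z - t *: gradient g z)
    <= g z - t * enorm (gradient g z) ^+ 2
       + L * t ^+ 2 * enorm (gradient g z) ^+ 2.
Proof.
move=> mu0 t0 cvx lip.
set p := gradient g z; set w := z - t *: p.
have := cvx w z.
have -> : z - w = t *: p by rewrite /w opprB addrCA subrr addr0.
have -> : gradient g w = p - (p - gradient g w) by rewrite subKr.
set e := p - gradient g w.
have le : enorm e <= L * (t * enorm p).
  have := lip w z; have -> : z - w = t *: p by rewrite /w opprB addrCA subrr addr0.
  by rewrite enormZ ger0_norm.
rewrite dotZr dotDl dotNl -enorm_sqr => h.
have p0 := enorm_ge0 p.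
have q : 0 <= mu / 2 * enorm (t *: p) ^+ 2 by rewrite mulr_ge0 ?divr_ge0 ?sqr_ge0.
have cs := cauchy_schwarz e p.
have k1 : enorm e * enorm p <= L * (t * enorm p) * enorm p by apply: ler_wpM2r.
have k2 : t * dot e p <= t * (L * (t * enorm p) * enorm p).
  by apply: ler_wpM2l => //; apply: le_trans k1.
nra.
Qed.

(** A descent step of length [1 / (2 * L)] lowers [g] by at least the squared gradient norm over
    [4 * L], which minimality forbids unless the gradient vanishes. *)
Lemma gradient_minimizer (R : realType) n (mu L : R) (g : 'rV[R]_n -> R)
    (z : 'rV[R]_n) :
  0 <= mu -> 0 < L -> strongly_convex mu g ->
  (forall u v, enorm (gradient g v - gradient g u) <= L * enorm (v - u)) ->
  (forall w, g z <= g w) -> gradient g z = 0.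
Proof.
move=> mu0 L0 cvx lip min.
have t0 : 0 <= (2 * L)^-1 by rewrite invr_ge0; lra.
have := gradient_descent z mu0 t0 cvx lip.
move/(le_trans (min _)); set p := enorm _ ^+ 2 => h.
have : p <= 0.
  have -> : p = 4 * L * ((2 * L)^-1 * p - L * (2 * L)^-1 ^+ 2 * p).
    by field; rewrite gt_eqF.
  by apply: mulr_ge0_le0; lra.
move=> p0; apply: enorm_eq0; apply/eqP; rewrite -sqrf_eq0; apply/eqP/le_anti.
by rewrite p0 sqr_ge0.
Qed.

(** A difference counts as nonnegative when the matching inequality is in the context. In this way
    the step-size bounds, multiplied by squares, become linear hints for [lra]. *)
Ltac nonneg := repeat first
  [ exact: sqr_ge0 | exact: enorm_ge0 | assumption | by apply: ltW
  | by rewrite subr_ge0 | by rewrite invr_ge0 ltW | apply: mulr_ge0 | apply: addr_ge0 ].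

(** * Functions of the class, one variable at a time *)

Lemma differentiable_sectiony (R : realType) dx dy
    (f : 'rV[R]_dx * 'rV[R]_dy -> R) x y :
  (forall z, differentiable f z) -> differentiable (fun y' => f (x, y')) y.
Proof.
by move=> df; exact: (@differentiable_comp _ _ _ _ (fun y' => (x, y')) f).
Qed.

Section function_class_lemmas.
Variables (R : realType) (dx dy : nat) (mux muy Lx Ly Lxy : R).
Variable f : 'rV[R]_dx * 'rV[R]_dy -> R.
Hypothesis fc : function_class mux muy Lx Ly Lxy f.

Lemma gradient_opp_sectiony x y :
  gradient (fun y' => - f (x, y')) y = - grady f x y.
Proof.
by rewrite gradientN//; apply: differentiable_sectiony; case: (fc_twice_differentiable fc).
Qed.

Lemma concavity_bound x y y' :
  f (x, y') <= f (x, y) + dot (grady f x y) (y' - y)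
               - muy / 2 * enorm (y' - y) ^+ 2.
Proof.
have := fc_strongly_concave fc x y y'.
rewrite gradient_opp_sectiony dotNl; lra.
Qed.

Lemma grady_opp_lipschitz x u v :
  enorm (gradient (fun y' => - f (x, y')) v - gradient (fun y' => - f (x, y')) u)
    <= Ly * enorm (v - u).
Proof.
by rewrite !gradient_opp_sectiony -opprD enormN (fc_grady_lip_y fc).
Qed.

Lemma gradient_ascent t x y : 0 <= muy -> 0 <= t ->
  f (x, y) + t * enorm (grady f x y) ^+ 2
    - Ly * t ^+ 2 * enorm (grady f x y) ^+ 2
    <= f (x, y + t *: grady f x y).
Proof.
move=> muy0 t0.
have := gradient_descent y muy0 t0 (fc_strongly_concave fc x) (grady_opp_lipschitz x).
rewrite gradient_opp_sectiony scalerN opprK enormN; lra.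
Qed.

Lemma nash_gradx xs ys : 0 <= mux -> 0 < Lx -> nash_equilibrium f xs ys ->
  gradx f xs ys = 0.
Proof.
move=> mux0 Lx0 [_ xmin].
apply: (gradient_minimizer mux0 Lx0 (fc_strongly_convex fc ys)) => // u v.
exact: (fc_gradx_lip_x fc u v ys).
Qed.

End function_class_lemmas.

(** * Algebra of the Lyapunov function and smallness of [C] *)

(** This is [2 p q <= u p^2 + q^2 / u], multiplied by [u] to avoid the division. With [u] the square
    root of [muy / mux], the coupling limits on both step sizes turn into the same constant [C]. *)
Lemma weighted_young (R : realFieldType) (C a b L u p q : R) :
  0 <= a -> 0 <= b -> 0 <= L -> 0 < u -> a * L <= C * u -> b * L * u <= C ->
  2 * (a * b * L * p * q) <= C * (a * p ^+ 2 + b * q ^+ 2).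
Proof.
move=> a0 b0 L0 u0 aL bL; rewrite -subr_ge0 -(pmulr_rge0 _ u0).
have k : 0 <= a * b * L * (u * p - q) ^+ 2 by nonneg.
have k1 : 0 <= b * q ^+ 2 * (C * u - a * L) by nonneg.
have k2 : 0 <= u * a * p ^+ 2 * (C - b * L * u).
  by nonneg.
lra.
Qed.

(** The terms of [psi_alex] shared by all indices, with [x - alpha *: g] in place of the next
    iterate, so that they depend on a single state. *)
Definition lyapunov_base (R : realType) dx dy (alpha beta : R)
    (xs : 'rV[R]_dx) (ys : 'rV[R]_dy) (x g : 'rV[R]_dx) (y : 'rV[R]_dy) :=
  lyap_V alpha beta xs ys x y + lyap_V alpha beta xs ys (x - alpha *: g) y
  - alpha * enorm g ^+ 2.

Lemma enorm_step_sqr (R : realType) n (t : R) (z zs p : 'rV[R]_n) :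
  enorm (z - t *: p - zs) ^+ 2
  = enorm (z - zs) ^+ 2 - 2 * t * dot p (z - zs) + t ^+ 2 * enorm p ^+ 2.
Proof.
rewrite (addrAC z) (enormB_sqr (z - zs)) dotZl enormZ exprMn.
by rewrite real_normK ?num_real//; ring.
Qed.

(** No squared norm of [g1] survives: the one produced by [x - alpha *: g - alpha *: g1] cancels
    against the last term of [lyapunov_base]. *)
Lemma lyapunov_base_update (R : realType) dx dy (alpha beta : R)
    (xs : 'rV[R]_dx) (ys : 'rV[R]_dy) (x g g1 : 'rV[R]_dx) (y h : 'rV[R]_dy) :
  alpha != 0 -> beta != 0 ->
  lyapunov_base alpha beta xs ys (x - alpha *: g) g1 (y + beta *: h)
  = lyapunov_base alpha beta xs ys x g y
    - 2 * dot g (x - xs) - 2 * dot g1 (x - alpha *: g - xs)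
    + 4 * dot h (y - ys)
    + 2 * (alpha * enorm g ^+ 2) + 2 * (beta * enorm h ^+ 2).
Proof.
move=> alphaN betaN; rewrite /lyapunov_base /lyap_V.
have -> : y + beta *: h = y - (- beta) *: h by rewrite scaleNr opprK.
rewrite (enorm_step_sqr alpha (x - alpha *: g)) !(enorm_step_sqr _ x).
rewrite (enorm_step_sqr _ y); field.
by rewrite alphaN betaN.
Qed.

(** These are the coefficients collected in [lyapunov_step] for [alpha |g|^2], [beta |h|^2] and
    [d beta |hp|^2]: on the left the errors of order [C], on the right the net gains due to
    over-extrapolation. Expanding [M] dominates each left-hand side monomial by monomial. *)
Lemma step_coefficients (R : realFieldType) (a d C : R) :
  0 <= a -> 0 <= d -> 0 <= C ->
  let M := 4 * (1 + a) ^+ 2 + 5 * (1 + a) * (1 + d) + 2 * (1 + d) ^+ 2 in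
  C * M <= a -> C * M <= d -> C * M <= 1 ->
  [/\ C * (2 * (1 + a) ^+ 2 + d * (1 + a) + 2 * a * (1 + a) + a * (1 + d)
           + 3 * a * d) <= 4 * a,
      C * (2 * (1 + d) ^+ 2 + a * (1 + d)) <= d
    & C * (2 * (1 + d) + (1 + a) + 2 * a) <= 2].
Proof.
move=> a0 d0 C0 M CMa CMd CM1.
have Ca : 0 <= C * a by nonneg.
have Cd : 0 <= C * d by nonneg.
have Caa : 0 <= C * a ^+ 2 by nonneg.
have Cdd : 0 <= C * d ^+ 2 by nonneg.
have Cad : 0 <= C * (a * d) by nonneg.
by split; move: CMa CMd CM1; rewrite /M; lra.
Qed.

(** * Decrease of the Lyapunov function in one step *)

Section step.
Variables (R : realType) (dx dy : nat) (mux muy Lx Ly Lxy : R).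
Variables (f : 'rV[R]_dx * 'rV[R]_dy -> R) (xs : 'rV[R]_dx) (ys : 'rV[R]_dy).
Hypotheses (mux0 : 0 < mux) (muy0 : 0 < muy).
Hypotheses (Lxy0 : 0 <= Lxy) (fc : function_class mux muy Lx Ly Lxy f).
Hypothesis nash : nash_equilibrium f xs ys.
Variables (a d C alpha beta u : R).
Hypotheses (a0 : 0 < a) (d0 : 0 < d) (C0 : 0 < C).
Hypotheses (alpha0 : 0 < alpha) (beta0 : 0 < beta) (u0 : 0 < u).
Hypotheses (aLx : alpha * Lx <= C) (bLy : beta * Ly <= C).
Hypotheses (aLxy : alpha * Lxy <= C * u) (bLxy : beta * Lxy * u <= C).
Local Notation gamma := (1 + a).
Local Notation delta := (1 + d).
Local Notation M := (4 * gamma ^+ 2 + 5 * gamma * delta + 2 * delta ^+ 2).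
Hypotheses (CMa : C * M <= a) (CMd : C * M <= d) (CM1 : C * M <= 1).

(* [hp] and [Q] stand for [h_k] and [|g_(k-1)|]; both are 0 when [k = 0]. *)
Variables (x : 'rV[R]_dx) (y hp : 'rV[R]_dy) (Q c rho : R).
Let yt := y + (d * beta) *: hp.
Let g := gradx f x yt.
Let xt1 := x - (gamma * alpha) *: g.
Let x1 := x - alpha *: g.
Let h := grady f xt1 y.
Let y1 := y + beta *: h.
Let yt1 := y + (delta * beta) *: h.
Let g1 := gradx f x1 yt1.
Hypothesis hp_err :
  enorm (hp - grady f xt1 yt) * enorm hp <=
  (Ly * (delta * beta * enorm hp)
   + Lxy * (gamma * alpha * enorm g + a * alpha * Q)) * enorm hp.

Let gamma_ge0 : 0 <= gamma. Proof. by have := a0; lra. Qed.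
Let delta_ge0 : 0 <= delta. Proof. by have := d0; lra. Qed.

(** The right-hand side is a path of one-variable moves; each of the next four lemmas bounds one of
    them. *)
Lemma gradient_inequalities :
  - 2 * dot g (x - xs) - 2 * dot g1 (x1 - xs) + 4 * dot h (y - ys)
  + mux * enorm (x - xs) ^+ 2 + mux * enorm (x1 - xs) ^+ 2
  + 2 * (muy * enorm (y - ys) ^+ 2)
  <= 2 * (f (xt1, yt) - f (x, yt)) + 2 * (f (xt1, y) - f (xt1, yt))
     + 2 * (f (xt1, y) - f (xt1, yt1)) + 2 * (f (xt1, yt1) - f (x1, yt1)).
Proof.
have c1 := fc_strongly_convex fc yt x xs.
have c2 := fc_strongly_convex fc yt1 x1 xs.
have c3 := concavity_bound fc xt1 y ys.
have [nx ny] := nash.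
(* The values at the equilibrium disappear because [f (xs, yt)] and [f (xs, yt1)] are at most
   [f (xs, ys)], which is at most [f (xt1, ys)]. *)
have n1 := nx yt; have n2 := nx yt1; have n3 := ny xt1.
rewrite -(opprB xs x) -(opprB xs x1) -(opprB ys y) !enormN !dotNr.
move: c1 c2 c3; rewrite -/(gradx f x yt) -/(gradx f x1 yt1) -/g -/g1 -/h.
lra.
Qed.

Local Notation G := (enorm g).
Local Notation H := (enorm h).
Local Notation P := (enorm hp).

Lemma extrapolation_descent :
  f (xt1, yt) - f (x, yt)
  <= - gamma * (alpha * G ^+ 2) + C * gamma ^+ 2 * (alpha * G ^+ 2).
Proof.
have t0 : 0 <= gamma * alpha by nonneg.
have := gradient_descent x (ltW mux0) t0 (fc_strongly_convex fc yt)
  (fun u v => fc_gradx_lip_x fc u v yt).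
rewrite -/(gradx f x yt) -/g -/xt1 => D.
have k : 0 <= (C - alpha * Lx) * (gamma ^+ 2 * (alpha * G ^+ 2)) by nonneg.
lra.
Qed.

Lemma extrapolation_ascent :
  f (xt1, y) - f (xt1, yt1)
  <= - delta * (beta * H ^+ 2) + C * delta ^+ 2 * (beta * H ^+ 2).
Proof.
have t0 : 0 <= delta * beta by nonneg.
have := gradient_ascent fc xt1 y (ltW muy0) t0.
rewrite -/h -/yt1 => D.
have k : 0 <= (C - beta * Ly) * (delta ^+ 2 * (beta * H ^+ 2)) by nonneg.
lra.
Qed.

Let young p q : 2 * (alpha * beta * Lxy * p * q)
  <= C * (alpha * p ^+ 2 + beta * q ^+ 2).
Proof. exact: weighted_young (ltW alpha0) (ltW beta0) Lxy0 u0 aLxy bLxy. Qed.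

(** Going from [yt] to [y] means moving against [hp], which is close to the ascent direction at
    [(xt1, yt)]; by concavity [f] drops. The mismatch of the two directions is what [hp_err]
    bounds. *)
Lemma dual_lookahead :
  2 * (f (xt1, y) - f (xt1, yt))
  <= d * (- 2 * (beta * P ^+ 2) + 2 * C * delta * (beta * P ^+ 2)
          + gamma * (C * (alpha * G ^+ 2 + beta * P ^+ 2))
          + a * C * (beta * P ^+ 2)) + a * d * alpha * beta * Lxy * u * Q ^+ 2.
Proof.
have := concavity_bound fc xt1 yt y.
have -> : y - yt = - ((d * beta) *: hp) by rewrite /yt opprD addNKr.
rewrite dotNr dotZr -[grady f xt1 yt](subKr hp) dotDl dotNl -enorm_sqr.
set e := hp - grady f xt1 yt.
set n := muy / 2 * _ => D.
have n0 : 0 <= n by nonneg.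
have db0 : 0 < d * beta by rewrite mulr_gt0.
have k1 : d * beta * dot e hp <= d * beta *
    ((Ly * (delta * beta * P) + Lxy * (gamma * alpha * G + a * alpha * Q)) * P).
  by apply: ler_wpM2l; [exact: ltW|apply: le_trans hp_err; exact: cauchy_schwarz].
have k2 : 0 <= (C - beta * Ly) * (d * delta * (beta * P ^+ 2)) by nonneg.
have k3 : 0 <= d * gamma * (C * (alpha * G ^+ 2 + beta * P ^+ 2)
                            - 2 * (alpha * beta * Lxy * G * P)).
  by nonneg.
(* [weighted_young] is not used here: the coefficient of [Q^2] must be exactly
   the one that the last term of the Lyapunov function pays for. *)
have k4 : 2 * (alpha * beta * Lxy * P * Q) <=
    alpha * beta * Lxy * u * Q ^+ 2 + C * (beta * P ^+ 2).
  rewrite -subr_ge0 -(pmulr_rge0 _ u0).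
  have q1 : 0 <= alpha * beta * Lxy * (u * Q - P) ^+ 2 by nonneg.
  have q2 : 0 <= beta * P ^+ 2 * (C * u - alpha * Lxy).
    by nonneg.
  lra.
have k5 : 0 <= d * a * (alpha * beta * Lxy * u * Q ^+ 2 + C * (beta * P ^+ 2)
                        - 2 * (alpha * beta * Lxy * P * Q)).
  by nonneg.
lra.
Qed.

(** Since [gamma > 1], [xt1] lies beyond [x1] along [- g], and convexity at [xt1] gives a further
    gain. The error of using [g] there is split at [(xt1, yt)]: first [x] changes, then [y]. *)
Lemma primal_lookahead :
  2 * (f (xt1, yt1) - f (x1, yt1))
  <= a * (- 2 * (alpha * G ^+ 2) + 2 * C * gamma * (alpha * G ^+ 2)
          + delta * (C * (alpha * G ^+ 2 + beta * H ^+ 2))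
          + d * (C * (alpha * G ^+ 2 + beta * P ^+ 2))).
Proof.
have := fc_strongly_convex fc yt1 xt1 x1.
rewrite -/(gradx f xt1 yt1).
have -> : x1 - xt1 = (a * alpha) *: g.
  rewrite /x1 /xt1 opprB addrC addrA subrK -scaleNr -scalerDl.
  by congr (_ *: _); ring.
rewrite dotZr -[gradx f xt1 yt1](subKr g) dotDl dotNl -enorm_sqr.
set e := g - gradx f xt1 yt1.
set n := mux / 2 * _ => D.
have n0 : 0 <= n by nonneg.
have ab0 : 0 <= a * alpha by nonneg.
have le : enorm e <= Lx * (gamma * alpha * G)
                     + Lxy * (delta * beta * H + d * beta * P).
  have -> : e = (gradx f x yt - gradx f xt1 yt) + (gradx f xt1 yt - gradx f xt1 yt1).
    by rewrite addrA subrK.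
  apply: le_trans (enormD _ _) _; apply: lerD.
    apply: le_trans (fc_gradx_lip_x fc _ _ _) _.
    by rewrite /xt1 subKr enormZ ger0_norm//; nonneg.
  apply: le_trans (fc_gradx_lip_y fc _ _ _) _; apply: ler_wpM2l => //.
  have -> : yt - yt1 = - ((delta * beta) *: h - (d * beta) *: hp).
    by rewrite /yt /yt1 opprB addrC opprD addrACA addNr add0r addrC.
  rewrite enormN; apply: le_trans (enormB _ _) _.
  by rewrite !enormZ !ger0_norm//; nonneg.
have k1 : a * alpha * dot e g <= a * alpha * ((Lx * (gamma * alpha * G)
    + Lxy * (delta * beta * H + d * beta * P)) * G).
  apply: ler_wpM2l => //; apply: le_trans (cauchy_schwarz _ _) _.
  by apply: ler_wpM2r => //; exact: enorm_ge0.
have k2 : 0 <= (C - alpha * Lx) * (a * gamma * (alpha * G ^+ 2)) by nonneg.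
have k3 : 0 <= a * delta * (C * (alpha * G ^+ 2 + beta * H ^+ 2)
                            - 2 * (alpha * beta * Lxy * G * H)).
  by nonneg.
have k4 : 0 <= a * d * (C * (alpha * G ^+ 2 + beta * P ^+ 2)
                            - 2 * (alpha * beta * Lxy * G * P)).
  by nonneg.
lra.
Qed.

Hypotheses (c_ub : c <= 2 * (a * d * alpha * beta * Lxy * u)).
Hypothesis c_rho : a * d * alpha * beta * Lxy * u <= rho * c.
Hypotheses (rho0 : 0 <= rho) (rho1 : rho <= 1).
Hypotheses (rhox : 1 - alpha * mux <= rho) (rhoy : 1 - beta * muy <= rho).

(** By [c_rho], the old term [c * Q ^+ 2] pays for the [Q ^+ 2] left by [dual_lookahead]; by [c_ub],
    the new term [c * G ^+ 2] is of order [C] and is absorbed by the gains. *)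
Lemma lyapunov_step :
  lyapunov_base alpha beta xs ys x1 g1 y1 + d * beta * H ^+ 2 + c * G ^+ 2
  <= rho * (lyapunov_base alpha beta xs ys x g y + d * beta * P ^+ 2 + c * Q ^+ 2).
Proof.
have i1 := gradient_inequalities.
have i2 := extrapolation_descent.
have i3 := extrapolation_ascent.
have i4 := dual_lookahead.
have i5 := primal_lookahead.
have alphaN := lt0r_neq0 alpha0; have betaN := lt0r_neq0 beta0.
(* As [1 - rho <= alpha * mux], the strong convexity terms cover the fraction [1 - rho] of the
   weighted distances. *)
have rX p : 0 <= p -> alpha^-1 * p - rho * (alpha^-1 * p) <= mux * p.
  move=> p0; have q : 0 <= alpha^-1 * p * (rho - (1 - alpha * mux)).
    by nonneg.
  have e : alpha^-1 * p * (alpha * mux) = mux * p by field.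
  lra.
have rY p : 0 <= p -> beta^-1 * p - rho * (beta^-1 * p) <= muy * p.
  move=> p0; have q : 0 <= beta^-1 * p * (rho - (1 - beta * muy)).
    by nonneg.
  have e : beta^-1 * p * (beta * muy) = muy * p by field.
  lra.
have rX0 := rX _ (sqr_ge0 (enorm (x - xs))).
have rX1 := rX _ (sqr_ge0 (enorm (x1 - xs))).
have rY0 := rY _ (sqr_ge0 (enorm (y - ys))).
set gg := alpha * G ^+ 2 in i2 i3 i4 i5 *.
have gg0 : 0 <= gg by nonneg.
set hh := beta * H ^+ 2 in i2 i3 i4 i5 *.
have hh0 : 0 <= hh by nonneg.
set pp := beta * P ^+ 2 in i2 i3 i4 i5 *.
have pp0 : 0 <= pp by nonneg.
have Qc : a * d * alpha * beta * Lxy * u * Q ^+ 2 <= rho * (c * Q ^+ 2).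
  by rewrite mulrA ler_wpM2r ?sqr_ge0.
have cG : c * G ^+ 2 <= 2 * a * d * C * gg.
  have q : 0 <= 2 * a * d * gg * (C - beta * Lxy * u) by nonneg.
  have := ler_wpM2r (sqr_ge0 G) c_ub; rewrite /gg in q *; lra.
have rgg : 0 <= (1 - rho) * gg by nonneg.
have rpp : 0 <= rho * (d * pp) by nonneg.
have d0' := ltW d0.
have [m1 m2 m3] := step_coefficients (ltW a0) d0' (ltW C0) CMa CMd CM1.
have s1 := ler_wpM2r gg0 m1.
have s2 := ler_wpM2r hh0 m2.
have s3 := ler_wpM2r (mulr_ge0 d0' pp0) m3.
have eP : d * beta * P ^+ 2 = d * pp by rewrite /pp mulrA.
have eH : d * beta * H ^+ 2 = d * hh by rewrite /hh mulrA.
rewrite [X in X + _ + _ <= _](lyapunov_base_update xs ys x g g1 y h alphaN betaN).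
rewrite -/x1 -/gg -/hh eP eH.
have base_le : lyapunov_base alpha beta xs ys x g y
    - rho * lyapunov_base alpha beta xs ys x g y
    <= mux * enorm (x - xs) ^+ 2 + mux * enorm (x1 - xs) ^+ 2
       + 2 * (muy * enorm (y - ys) ^+ 2).
  rewrite /lyapunov_base /lyap_V -/x1 -/gg; lra.
lra.
Qed.
End step.

(** * Consequences of the step-size bounds *)

(** The last bound produces the complexity: the inverse of a minimum is the maximum of the inverses,
    hence at most their sum. *)
Lemma step_boundP (R : realType) (L Lxy mu nu : R) :
  0 < L -> 0 <= Lxy -> 0 < mu -> 0 < nu ->
  [/\ 0 < step_bound L Lxy mu nu, step_bound L Lxy mu nu * L <= 1,
      step_bound L Lxy mu nu * Lxy <= Num.sqrt (nu / mu)
    & (step_bound L Lxy mu nu)^-1 <= L + mu * (Lxy / Num.sqrt (mu * nu))].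
Proof.
move=> L0 Lxy0 mu0 nu0; rewrite /step_bound.
have m0 : 0 < Num.sqrt mu by rewrite sqrtr_gt0.
have n0 : 0 < Num.sqrt nu by rewrite sqrtr_gt0.
have mu2 : Num.sqrt mu ^+ 2 = mu by rewrite sqr_sqrtr// ltW.
have -> : Num.sqrt (nu / mu) = Num.sqrt nu / Num.sqrt mu.
  by rewrite sqrtrM ?(ltW nu0)// sqrtrV // ltW.
rewrite sqrtrM ?(ltW mu0)// div1r; case: eqVneq => [->|Lxy_neq0].
  rewrite mul0r !mulr0 mulVf ?gt_eqF// invrK invr_gt0 addr0.
  by split=> //; rewrite divr_ge0// ltW.
have l0 : 0 < Lxy by rewrite lt_neqAle eq_sym Lxy_neq0.
set w := Num.sqrt nu / (Lxy * Num.sqrt mu).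
have w0 : 0 < w by rewrite divr_gt0// mulr_gt0.
split.
- by rewrite lt_min invr_gt0 L0 w0.
- rewrite -(mulVf (lt0r_neq0 L0)) ler_pM2r//; by rewrite ge_min lexx.
- have -> : Num.sqrt nu / Num.sqrt mu = w * Lxy.
    by rewrite /w; field; rewrite !gt_eqF.
  by rewrite ler_pM2r// ge_min lexx orbT.
- have -> : mu * (Lxy / (Num.sqrt mu * Num.sqrt nu)) = w^-1.
    by rewrite -{1}mu2 /w; field; rewrite !gt_eqF.
  have wi0 : 0 < w^-1 by rewrite invr_gt0.
  by rewrite minEle; case: ifP => _; rewrite ?invrK; lra.
Qed.

(** * Lower bound on the Lyapunov function *)

(** The x-gradient vanishes at the equilibrium, so its norm is at most a sum of three Lipschitz
    terms; the factor 3 comes from squaring that sum. *)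
Lemma gradient_norm_sqr_le (R : realType) dx dy (mux muy Lx Ly Lxy C alpha beta u d : R)
    (f : 'rV[R]_dx * 'rV[R]_dy -> R) xs ys x y hp :
  function_class mux muy Lx Ly Lxy f -> nash_equilibrium f xs ys ->
  0 < mux -> 0 < Lx -> 0 <= Lxy -> 0 <= C ->
  0 < alpha -> 0 < beta -> 0 <= d -> 0 < u ->
  alpha * Lx <= C -> alpha * Lxy <= C * u -> beta * Lxy * u <= C ->
  alpha * enorm (gradx f x (y + (d * beta) *: hp)) ^+ 2
  <= 3 * C ^+ 2 * (alpha^-1 * enorm (x - xs) ^+ 2 + beta^-1 * enorm (y - ys) ^+ 2
                   + d ^+ 2 * (beta * enorm hp ^+ 2)).
Proof.
move=> fc nash mux0 Lx0 Lxy0 C0 alpha0 beta0 d0 u0 aLx aLxy bLxy.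
set yt := y + _; set g := gradx f x yt.
have le : enorm g <= Lx * enorm (x - xs)
                     + Lxy * (enorm (y - ys) + d * beta * enorm hp).
  have -> : g = (gradx f x yt - gradx f xs yt) + (gradx f xs yt - gradx f xs ys).
    by rewrite addrA subrK (nash_gradx fc (ltW mux0) Lx0 nash) subr0.
  apply: le_trans (enormD _ _) _; apply: lerD; first exact: (fc_gradx_lip_x fc).
  apply: le_trans (fc_gradx_lip_y fc _ _ _) _; apply: ler_wpM2l => //.
  have -> : yt - ys = (y - ys) + (d * beta) *: hp by rewrite /yt addrAC.
  apply: le_trans (enormD _ _) _.
  by rewrite enormZ ger0_norm//; nonneg.
set X := enorm (x - xs) in le *; set Y := enorm (y - ys) in le *.
set P := enorm hp in le *.
have X0 : 0 <= X by nonneg.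
have Y0 : 0 <= Y by nonneg.
have P0 : 0 <= P by nonneg.
have sq : enorm g ^+ 2 <= 3 * ((Lx * X) ^+ 2 + (Lxy * Y) ^+ 2
                               + (Lxy * (d * beta * P)) ^+ 2).
  apply: (@le_trans _ _ ((Lx * X + Lxy * (Y + d * beta * P)) ^+ 2)).
    by rewrite ler_pXn2r ?nnegrE//; nonneg.
  rewrite -subr_ge0; set p := Lx * X; set q := Lxy * Y; set r := Lxy * _.
  have -> : Lxy * (Y + d * beta * P) = q + r by rewrite mulrDr.
  have := sqr_ge0 (p - q); have := sqr_ge0 (p - r); have := sqr_ge0 (q - r).
  lra.
have aL2 : (alpha * Lx) ^+ 2 <= C ^+ 2 by rewrite ler_pXn2r ?nnegrE//; nonneg.
(* Multiplying the two coupling bounds makes the weight [u] cancel. *)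
have abL2 : alpha * beta * Lxy ^+ 2 <= C ^+ 2.
  rewrite -(ler_pM2r u0).
  have q1 : 0 <= beta * Lxy * u * (C * u - alpha * Lxy) by nonneg.
  have q2 : 0 <= C * u * (C - beta * Lxy * u) by nonneg.
  lra.
have ia : 0 <= alpha^-1 * X ^+ 2 by nonneg.
have ib : 0 <= beta^-1 * Y ^+ 2 by nonneg.
have ip : 0 <= d ^+ 2 * (beta * P ^+ 2) by nonneg.
apply: le_trans (ler_wpM2l (ltW alpha0) sq) _.
have e1 : alpha * (Lx * X) ^+ 2 = (alpha * Lx) ^+ 2 * (alpha^-1 * X ^+ 2).
  by field; rewrite gt_eqF.
have e2 : alpha * (Lxy * Y) ^+ 2 = alpha * beta * Lxy ^+ 2 * (beta^-1 * Y ^+ 2).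
  by field; rewrite gt_eqF.
have e3 : alpha * (Lxy * (d * beta * P)) ^+ 2
          = alpha * beta * Lxy ^+ 2 * (d ^+ 2 * (beta * P ^+ 2)) by ring.
have l1 := ler_wpM2r ia aL2.
have l2 := ler_wpM2r ib abL2.
have l3 := ler_wpM2r ip abL2.
lra.
Qed.

(** The negative term [alpha |g|^2] consumes at most half of the first [lyap_V] and all of
    [d beta |hp|^2]. This explains the 2 in [1 / (2 * alpha)]; the y-distance occurs twice, so it
    keeps [1 / beta]. *)
Lemma lyapunov_lower_bound (R : realType) dx dy
    (mux muy Lx Ly Lxy C alpha beta u d : R)
    (f : 'rV[R]_dx * 'rV[R]_dy -> R) xs ys x y hp :
  function_class mux muy Lx Ly Lxy f -> nash_equilibrium f xs ys ->
  0 < mux -> 0 < Lx -> 0 <= Lxy -> 0 <= C ->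
  0 < alpha -> 0 < beta -> 0 <= d -> 0 < u ->
  alpha * Lx <= C -> alpha * Lxy <= C * u -> beta * Lxy * u <= C ->
  6 * C ^+ 2 <= 1 -> 3 * C ^+ 2 * d <= 1 ->
  A_alex alpha beta * (enorm (x - xs) ^+ 2 + enorm (y - ys) ^+ 2)
  <= lyapunov_base alpha beta xs ys x (gradx f x (y + (d * beta) *: hp)) y
     + d * beta * enorm hp ^+ 2.
Proof.
move=> fc nash mux0 Lx0 Lxy0 C0 alpha0 beta0 d0 u0 aLx aLxy bLxy C6 Cd.
have := gradient_norm_sqr_le x y hp fc nash mux0 Lx0 Lxy0 C0 alpha0 beta0 d0
  u0 aLx aLxy bLxy.
set g := gradx _ _ _ => le; rewrite /lyapunov_base /lyap_V.
have i1 : A_alex alpha beta * enorm (x - xs) ^+ 2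
          <= alpha^-1 * enorm (x - xs) ^+ 2 / 2.
  rewrite mulrAC ler_wpM2r ?sqr_ge0// /A_alex ge_min div1r invfM mulrC lexx//.
have i2 : A_alex alpha beta * enorm (y - ys) ^+ 2
          <= beta^-1 * enorm (y - ys) ^+ 2.
  by rewrite ler_wpM2r ?sqr_ge0// /A_alex ge_min !div1r lexx orbT.
have ia : 0 <= alpha^-1 * enorm (x - xs) ^+ 2 by nonneg.
have ia1 : 0 <= alpha^-1 * enorm (x - alpha *: g - xs) ^+ 2 by nonneg.
have ib : 0 <= beta^-1 * enorm (y - ys) ^+ 2 by nonneg.
have ip : 0 <= d * (beta * enorm hp ^+ 2) by nonneg.
have l1 := ler_wpM2r (addr_ge0 ia ib) C6.
have l2 := ler_wpM2r ip Cd.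
lra.
Qed.

(** Expanding the second factor shows that it is at least 11 and at least [2 * d]. *)
Lemma step_constant_small (R : realFieldType) (a d C : R) :
  0 <= a -> 0 <= d -> 0 <= C ->
  C * (4 * (1 + a) ^+ 2 + 5 * (1 + a) * (1 + d) + 2 * (1 + d) ^+ 2) <= 1 ->
  11 * C <= 1 /\ 2 * (C * d) <= 1.
Proof.
move=> a0 d0 C0 CM1.
have Ca : 0 <= C * a by nonneg.
have Cd : 0 <= C * d by nonneg.
have Caa : 0 <= C * a ^+ 2 by nonneg.
have Cdd : 0 <= C * d ^+ 2 by nonneg.
have Cad : 0 <= C * (a * d) by nonneg.
by split; move: CM1; lra.
Qed.

(** * Contraction and lower bound along the iterates *)

Section psi.
Variables (R : realType) (dx dy : nat) (mux muy Lx Ly Lxy : R).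
Variables (f : 'rV[R]_dx * 'rV[R]_dy -> R) (xs : 'rV[R]_dx) (ys : 'rV[R]_dy).
Hypotheses (mux0 : 0 < mux) (muxL : mux <= Lx) (muy0 : 0 < muy) (muyL : muy <= Ly).
Hypotheses (Lxy0 : 0 <= Lxy) (fc : function_class mux muy Lx Ly Lxy f).
Hypothesis nash : nash_equilibrium f xs ys.
Variables (a d C alpha beta : R).
Hypotheses (a0 : 0 < a) (d0 : 0 < d) (C0 : 0 < C).
Local Notation gamma := (1 + a).
Local Notation delta := (1 + d).
Local Notation M := (4 * gamma ^+ 2 + 5 * gamma * delta + 2 * delta ^+ 2).
Hypotheses (CMa : C * M <= a) (CMd : C * M <= d) (CM1 : C * M <= 1).
Hypotheses (alpha0 : 0 < alpha) (alpha_le : alpha <= C * step_bound Lx Lxy mux muy).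
Hypotheses (beta0 : 0 < beta) (beta_le : beta <= C * step_bound Ly Lxy muy mux).
Variables (x xt : nat -> 'rV[R]_dx) (y yt : nat -> 'rV[R]_dy).
Hypothesis alex : alex_gda f alpha beta gamma delta x xt y yt.

Local Notation u := (Num.sqrt (muy / mux)).
Local Notation psi :=
  (psi_alex f mux muy Lxy alpha beta gamma delta xs ys x xt y yt).
Local Notation rho := (Num.max (1 - alpha * mux) (1 - beta * muy)).
Local Notation base := (lyapunov_base alpha beta xs ys).
Local Notation g k := (gradx f (x k) (yt k)).
Local Notation h k := (grady f (xt k.+1) (y k)).
Local Notation N := (a * d * alpha * beta).
Local Notation c := (N / (1 - alpha * mux) * (Lxy * u)).

Let Lx0 : 0 < Lx. Proof. exact: lt_le_trans muxL. Qed.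
Let Ly0 : 0 < Ly. Proof. exact: lt_le_trans muyL. Qed.
Let u0 : 0 < u. Proof. by rewrite sqrtr_gt0 divr_gt0. Qed.

Let aLx : alpha * Lx <= C.
Proof.
have [_ s _ _] := step_boundP Lx0 Lxy0 mux0 muy0.
apply: le_trans (ler_wpM2r (ltW Lx0) alpha_le) _.
by rewrite -mulrA ler_piMr// ltW.
Qed.

Let bLy : beta * Ly <= C.
Proof.
have [_ s _ _] := step_boundP Ly0 Lxy0 muy0 mux0.
apply: le_trans (ler_wpM2r (ltW Ly0) beta_le) _.
by rewrite -mulrA ler_piMr// ltW.
Qed.

Let aLxy : alpha * Lxy <= C * u.
Proof.
have [_ _ s _] := step_boundP Lx0 Lxy0 mux0 muy0.
apply: le_trans (ler_wpM2r Lxy0 alpha_le) _.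
by rewrite -mulrA ler_wpM2l// ltW.
Qed.

Let bLxy : beta * Lxy * u <= C.
Proof.
have [_ _ s _] := step_boundP Ly0 Lxy0 muy0 mux0.
(* The y-bound has the roles of [mux] and [muy] exchanged, so its square root is the inverse of
   [u]. *)
have -> : C = C * Num.sqrt (mux / muy) * u.
  rewrite -mulrA -sqrtrM ?divr_ge0 ?ltW// mulrA mulrVK ?unitfE ?gt_eqF//.
  by rewrite divff ?gt_eqF// sqrtr1 mulr1.
apply: ler_wpM2r; first exact: ltW.
apply: le_trans (ler_wpM2r Lxy0 beta_le) _.
by rewrite -mulrA ler_wpM2l// ltW.
Qed.

Let small : 11 * C <= 1 /\ 2 * (C * d) <= 1.
Proof. exact: step_constant_small (ltW a0) (ltW d0) (ltW C0) CM1. Qed.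

Let amux : 0 < 1 - alpha * mux.
Proof.
have [] := small; have := ler_wpM2l (ltW alpha0) muxL; have := aLx; lra.
Qed.

Let bmuy : 0 < 1 - beta * muy.
Proof.
have [] := small; have := ler_wpM2l (ltW beta0) muyL; have := bLy; lra.
Qed.

Let amux0 : 0 < alpha * mux. Proof. exact: mulr_gt0. Qed.
Let bmuy0 : 0 < beta * muy. Proof. exact: mulr_gt0. Qed.

Let rho_ge0 : 0 <= rho. Proof. by rewrite le_max (ltW amux). Qed.
Let rho_le1 : rho <= 1.
Proof. by rewrite ge_max; have := amux0; have := bmuy0; lra. Qed.

Let N0 : 0 <= N. Proof. by nonneg. Qed.
Let r0 : 0 <= Lxy * u. Proof. by rewrite mulr_ge0// ltW. Qed.
Let c0 : 0 <= c.
Proof. by rewrite mulr_ge0// divr_ge0// ltW. Qed.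

Let cE : N * Lxy * u = (1 - alpha * mux) * c.
Proof. by field; rewrite gt_eqF. Qed.

Let c_ub : c <= 2 * (N * Lxy * u).
Proof.
rewrite cE [leRHS]mulrA; apply: ler_peMl => //.
(* Here [alpha * mux <= alpha * Lx <= C <= 1 / 11], hence [1 - alpha * mux] is at least one half. *)
have [] := small; have := ler_wpM2l (ltW alpha0) muxL; have := aLx; lra.
Qed.

(** The division by [1 - alpha * mux] in the Lyapunov function serves this bound, as [rho] is at
    least that denominator. *)
Let c_rho : N * Lxy * u <= rho * c.
Proof. by rewrite cE ler_wpM2r// le_max lexx. Qed.

Let psi_succ k : psi k.+1 = base (x k.+1) (g k.+1) (y k.+1)
  + d * beta * enorm (h k) ^+ 2 + c * enorm (g k) ^+ 2.
Proof.
by rewrite /psi_alex /= [1 + a - 1]addrC addKr [1 + d - 1]addrC addKr (alex_x alex k.+1).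
Qed.

Let psi0_ge : base (x 0%N) (g 0%N) (y 0%N) <= psi 0%N.
Proof.
rewrite /psi_alex /= [1 + a - 1]addrC addKr [1 + d - 1]addrC addKr (alex_x alex 0).
have ia : 0 <= ((1 - alpha * mux) * (1 - beta * muy))^-1.
  by rewrite invr_ge0 mulr_ge0// ltW.
by rewrite lerDl; nonneg.
Qed.

Let lookahead k : yt k.+1 = y k.+1 + (d * beta) *: h k.
Proof.
rewrite (alex_yt alex) (alex_y alex) -addrA -scalerDl.
by congr (_ + _ *: _); ring.
Qed.

Let lookahead_step k : yt k.+1 - y k = (delta * beta) *: h k.
Proof. by rewrite (alex_yt alex) addrC addKr. Qed.

(** Origin of the last term of [psi_alex]: [xt k.+1 - xt k.+2] equals
    [gamma alpha g_(k+1) - a alpha g_k], so the previous gradient enters. *)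
Let h_error k :
  enorm (h k - grady f (xt k.+2) (yt k.+1))
  <= Ly * (delta * beta * enorm (h k))
     + Lxy * (gamma * alpha * enorm (g k.+1) + a * alpha * enorm (g k)).
Proof.
have -> : h k - grady f (xt k.+2) (yt k.+1) =
    (h k - grady f (xt k.+1) (yt k.+1))
    + (grady f (xt k.+1) (yt k.+1) - grady f (xt k.+2) (yt k.+1)).
  by rewrite addrA subrK.
have g0 : 0 <= gamma by have := a0; lra.
have dl0 : 0 <= delta by have := d0; lra.
apply: le_trans (enormD _ _) _; apply: lerD.
  apply: le_trans (fc_grady_lip_y fc _ _ _) _; apply: ler_wpM2l; first exact: ltW.
  rewrite -opprB enormN lookahead_step enormZ ger0_norm//.
  by nonneg.
apply: le_trans (fc_grady_lip_x fc _ _ _) _; apply: ler_wpM2l => //.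
have -> : xt k.+1 - xt k.+2 = (gamma * alpha) *: g k.+1 - (a * alpha) *: g k.
  rewrite !(alex_xt alex) (alex_x alex k) opprB addrCA; congr (_ + _).
  apply/rowP => i; rewrite !mxE; ring.
apply: le_trans (enormB _ _) _; rewrite !enormZ !ger0_norm//; nonneg.
Qed.

Lemma rate_ge0 : 0 <= rho. Proof. exact: rho_ge0. Qed.

Lemma psi_contraction k : psi k.+1 <= rho * psi k.
Proof.
have rx : 1 - alpha * mux <= rho by rewrite le_max lexx.
have ry : 1 - beta * muy <= rho by rewrite le_max lexx orbT.
have step hp Q : yt k = y k + (d * beta) *: hp ->
    enorm (hp - grady f (xt k.+1) (yt k)) * enorm hp <=
    (Ly * (delta * beta * enorm hp)
     + Lxy * (gamma * alpha * enorm (g k) + a * alpha * Q)) * enorm hp ->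
    psi k.+1 <= rho * (base (x k) (g k) (y k) + d * beta * enorm hp ^+ 2 + c * Q ^+ 2).
  move=> ytE err; rewrite psi_succ.
  have := lyapunov_step mux0 muy0 Lxy0 fc nash a0 d0 C0 alpha0 beta0 u0 aLx bLy
    aLxy bLxy CMa CMd CM1 (x := x k) (y := y k) (hp := hp) (Q := Q) (c := c)
    (rho := rho).
  rewrite -ytE -!(alex_x alex) -!(alex_xt alex) -!(alex_y alex) -!(alex_yt alex).
  exact.
case: k => [|k] in step *.
  (* At the start [hp] and [Q] are 0; the factor [enorm hp] on both sides of the error hypothesis
     makes it trivial there. *)
  have := step 0 0; rewrite enorm0 scaler0 addr0 (alex_yt0 alex) !mulr0 !expr0n !mulr0 !addr0.
  move=> /(_ erefl (lexx 0)) s; apply: le_trans s _.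
  by rewrite ler_wpM2l// -[X in gradx f _ X](alex_yt0 alex).
rewrite [in leRHS]psi_succ; apply: step => //.
by apply: ler_wpM2r; [exact: enorm_ge0|exact: h_error].
Qed.

Lemma psi_lower_bound k :
  A_alex alpha beta * (enorm (x k - xs) ^+ 2 + enorm (y k - ys) ^+ 2) <= psi k.
Proof.
have [C11 Cd] := small.
have C6 : 6 * C ^+ 2 <= 1.
  have : 0 <= C * (1 - 11 * C) by nonneg.
  lra.
have C3 : 3 * C ^+ 2 * d <= 1.
  have : 0 <= 3 * C * (1 - 2 * (C * d)) by nonneg.
  lra.
have lb hp := lyapunov_lower_bound (x k) (y k) hp fc nash mux0 Lx0 Lxy0 (ltW C0)
  alpha0 beta0 (ltW d0) u0 aLx aLxy bLxy C6 C3.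
case: k => [|k] in lb *.
  apply: le_trans psi0_ge; have := lb 0.
  by rewrite enorm0 scaler0 addr0 (alex_yt0 alex) expr0n mulr0 addr0.
rewrite psi_succ; apply: le_trans (lb (h k)) _.
by rewrite -lookahead lerDl mulr_ge0 ?sqr_ge0.
Qed.

Lemma psi_geometric k : psi k <= rho ^+ k * psi 0%N.
Proof.
elim: k => [|k IH]; first by rewrite expr0 mul1r.
apply: le_trans (psi_contraction k) _.
by rewrite exprS -mulrA ler_wpM2l.
Qed.
End psi.

(** * From contraction to iteration count *)

(** By [step_boundP], each maximal step size times its strong convexity constant is at least
    [C / kappa]; then [1 - t <= exp (- t)]. *)
Lemma rate_le_expR (R : realType) (C mux muy Lx Ly Lxy : R) :
  0 < C -> 0 < mux -> mux <= Lx -> 0 < muy -> muy <= Ly -> 0 <= Lxy ->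
  let kappa := Lx / mux + Ly / muy + Lxy / Num.sqrt (mux * muy) in
  0 < kappa /\
  Num.max (1 - C * step_bound Lx Lxy mux muy * mux)
          (1 - C * step_bound Ly Lxy muy mux * muy) <= expR (- (C / kappa)).
Proof.
move=> C0 mux0 muxL muy0 muyL Lxy0 kappa.
have Lx0 := lt_le_trans mux0 muxL; have Ly0 := lt_le_trans muy0 muyL.
have kx : 0 < Lx / mux by rewrite divr_gt0.
have ky : 0 < Ly / muy by rewrite divr_gt0.
have kxy : 0 <= Lxy / Num.sqrt (mux * muy) by rewrite divr_ge0// sqrtr_ge0.
have kappa0 : 0 < kappa by rewrite ltr_wpDr// addr_gt0.
split=> //.
have key (L Ml mu nu : R) : 0 < L -> 0 < mu -> 0 < nu ->
    L / mu + Lxy / Num.sqrt (mu * nu) <= kappa ->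
    1 - C * step_bound L Lxy mu nu * mu <= expR (- (C / kappa)).
  move=> L0 mu0 nu0 le_kappa; apply: le_trans (expR_ge1Dx _); rewrite lerD2l lerN2.
  have [s0 _ _ s] := step_boundP L0 Lxy0 mu0 nu0.
  rewrite -mulrA ler_wpM2l ?(ltW C0)// -[leRHS]invrK.
  rewrite lef_pV2 ?posrE ?invr_gt0 ?mulr_gt0// invfM.
  apply: le_trans le_kappa.
  rewrite ler_pdivrMr//; apply: le_trans s _.
  by rewrite mulrDl divfK ?gt_eqF// (mulrC mu).
rewrite ge_max; apply/andP; split; apply: key => //.
- by rewrite /kappa; lra.
- by rewrite (mulrC muy) /kappa; lra.
Qed.

Lemma iteration_count (R : realType) (C kappa p0 A eps t s : R) (K : nat) :
  0 < C -> 0 < kappa -> 0 < A -> 0 < eps ->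
  0 <= t -> t <= expR (- (C / kappa)) -> A * s <= t ^+ K * p0 ->
  ((C^-1 * kappa)%:E * lne (p0 / (A * eps))%:E <= K%:R%:E)%E -> s <= eps.
Proof.
move=> C0 kappa0 A0 eps0 t0 t_le As.
have Ae0 : 0 < A * eps by rewrite mulr_gt0.
rewrite -(ler_pM2l A0) => le_K; apply: le_trans As _.
(* A nonpositive [p0], where the logarithm is degenerate, is settled by
   [A * s <= t ^+ K * p0 <= 0]. *)
have [p_le0|p_gt0] := leP p0 0.
  by apply: (@le_trans _ _ 0); [rewrite mulr_ge0_le0// exprn_ge0|exact: ltW].
have q0 : 0 < p0 / (A * eps) by rewrite divr_gt0.
move: le_K; rewrite lne_EFin// -EFinM lee_fin => le_K.
apply: (@le_trans _ _ (expR (- (C / kappa)) ^+ K * p0)).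
  by rewrite ler_wpM2r ?(ltW p_gt0)// lerXn2r ?nnegrE// expR_ge0.
rewrite -expRM_natl -ler_pdivlMr//.
have -> : A * eps / p0 = expR (- ln (p0 / (A * eps))).
  by rewrite expRN lnK ?posrE// invf_div.
rewrite ler_expR mulrN lerN2.
have -> : K%:R * (C / kappa) = (K%:R) / (C^-1 * kappa) by rewrite invfM invrK.
by rewrite ler_pdivlMr ?mulr_gt0 ?invr_gt0// mulrC.
Qed.

Theorem corollary5p2 (R : realType) (gamma delta : R)
    (hgamma : 1 < gamma) (hdelta : 1 < delta) :
  exists C C' : R, 0 < C /\ 0 < C' /\
  forall (dx dy : nat) (mux muy Lx Ly Lxy : R)
    (f : 'rV[R]_dx * 'rV[R]_dy -> R)
    (xs : 'rV[R]_dx) (ys : 'rV[R]_dy),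
  0 < mux -> mux <= Lx -> 0 < muy -> muy <= Ly -> 0 <= Lxy ->
  function_class mux muy Lx Ly Lxy f ->
  nash_equilibrium f xs ys ->
  let alpha_max := C * step_bound Lx Lxy mux muy in
  let beta_max := C * step_bound Ly Lxy muy mux in
  let kappax := Lx / mux in
  let kappay := Ly / muy in
  let kappaxy := Lxy / Num.sqrt (mux * muy) in
  (forall (alpha beta : R)
      (x xt : nat -> 'rV[R]_dx) (y yt : nat -> 'rV[R]_dy),
    0 < alpha -> alpha <= alpha_max -> 0 < beta -> beta <= beta_max ->
    alex_gda f alpha beta gamma delta x xt y yt ->
    let Psi := psi_alex f mux muy Lxy alpha beta gamma delta xs ys x xt y yt in
    forall k : nat,
      Psi k.+1 <= Num.max (1 - alpha * mux) (1 - beta * muy) * Psi k)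
  /\
  (0 < A_alex alpha_max beta_max /\
   forall (x xt : nat -> 'rV[R]_dx) (y yt : nat -> 'rV[R]_dy),
    alex_gda f alpha_max beta_max gamma delta x xt y yt ->
    let Psi := psi_alex f mux muy Lxy alpha_max beta_max gamma delta
                 xs ys x xt y yt in
    forall (eps : R) (K : nat), 0 < eps ->
      ((C' * (kappax + kappay + kappaxy))%:E
         * lne (Psi 0%N / (A_alex alpha_max beta_max * eps))%:E
       <= (K%:R)%:E)%E ->
      enorm (x K - xs) ^+ 2 + enorm (y K - ys) ^+ 2 <= eps).
Proof.
have [a aE] : exists a, gamma = 1 + a by exists (gamma - 1); rewrite addrC subrK.
have [d dE] : exists d, delta = 1 + d by exists (delta - 1); rewrite addrC subrK.
move: hgamma hdelta; rewrite {}aE {}dE !ltrDl => a0 d0.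
pose M := 4 * (1 + a) ^+ 2 + 5 * (1 + a) * (1 + d) + 2 * (1 + d) ^+ 2.
have M0 : 0 < M.
  have g0 : 0 < 1 + a by lra.
  have l0 : 0 < 1 + d by lra.
  by rewrite !addr_gt0// !mulr_gt0// exprn_gt0.
(* With [C = m / M] the product [C * M] is [m], which gives the three smallness conditions at
   once. *)
pose m := Num.min (Num.min a d) 1.
have m0 : 0 < m by rewrite !lt_min a0 d0 ltr01.
have C0 : 0 < m / M by rewrite divr_gt0.
have CM : m / M * M = m by rewrite mulfVK// gt_eqF.
have CMa : m / M * M <= a by rewrite CM !ge_min lexx.
have CMd : m / M * M <= d by rewrite CM !ge_min lexx orbT.
have CM1 : m / M * M <= 1 by rewrite CM !ge_min lexx orbT.
(* The rate is [exp (- C / kappa)], hence [C'] is the inverse of [C]. *)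
exists (m / M), (m / M)^-1; split=> //; split; first by rewrite invr_gt0.
move: (m / M) C0 CMa CMd CM1 => {m m0 CM} C C0 CMa CMd CM1.
move=> dx dy mux muy Lx Ly Lxy f xs ys mux0 muxL muy0 muyL Lxy0 fc nash.
move=> alpha_max beta_max kappax kappay kappaxy.
have Lx0 := lt_le_trans mux0 muxL; have Ly0 := lt_le_trans muy0 muyL.
have alpha0 : 0 < alpha_max.
  by have [s _ _ _] := step_boundP Lx0 Lxy0 mux0 muy0; rewrite mulr_gt0.
have beta0 : 0 < beta_max.
  by have [s _ _ _] := step_boundP Ly0 Lxy0 muy0 mux0; rewrite mulr_gt0.
have A0 : 0 < A_alex alpha_max beta_max.
  by rewrite lt_min !divr_gt0// mulr_gt0.
split.
  move=> alpha beta x xt y yt ? ? ? ? alex Psi k.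
  exact: (psi_contraction mux0 muxL muy0 muyL Lxy0 fc nash a0 d0 C0 CMa CMd CM1).
split=> // x xt y yt alex Psi eps K eps0.
have [kappa0 rate] := rate_le_expR C0 mux0 muxL muy0 muyL Lxy0.
have geo := psi_geometric mux0 muxL muy0 muyL Lxy0 fc nash a0 d0 C0 CMa CMd CM1
  alpha0 (lexx _) beta0 (lexx _) alex K.
have low := psi_lower_bound mux0 muxL muy0 muyL Lxy0 fc nash a0 d0 C0 CM1
  alpha0 (lexx _) beta0 (lexx _) alex K.
apply: (iteration_count C0 kappa0 A0 eps0 _ rate); last exact: le_trans low geo.
exact: (rate_ge0 mux0 muxL muy0 Lxy0 _ a0 d0 C0 CM1 alpha0 (lexx _)).
Qed.
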